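(* Let $(A,\mu)$ be a Jordan algebra, with $\mu(x,y)$ written $xy$, and let $\alpha\colon A\to A$ be an algebra morphism. Let $\{,,\}$ be the triple product on $A$ given by $$\{xyz\}=x(yz)+(xy)z-y(xz).$$ Then $A_\alpha=(A,\ \{,,\}_\alpha=\alpha\circ\{,,\},\ \alpha)$ (with both twisting maps equal to $\alpha$) is a multiplicative Hom-Jordan triple system.
   Context: We work over a fixed field $\mathbf{k}$ of characteristic $0$. A Jordan algebra $(A,\mu)$ is a $\mathbf{k}$-module with a bilinear commutative multiplication $\mu$ such that $(x^2y)x=x^2(yx)$ for all $x,y\in A$, where $x^2=\mu(x,x)$. An algebra morphism $\alpha\colon A\to A$ is a linear map with $\alpha(xy)=\alpha(x)\alpha(y)$. A Hom-Jordan triple system $(J,\{,,\},(\alpha_1,\alpha_2))$ is a $\mathbf{k}$-module $J$ with a trilinear map $\{,,\}\colon J^{\otimes 3}\to J$ and linear maps $\alpha_1,\alpha_2\colon J\to J$ (twisting maps) such that $\{xyz\}=\{zyx\}$ and $$\{\alpha_1(x)\alpha_2(y)\{uvw\}\}-\{\alpha_1(u)\alpha_2(v)\{xyw\}\}=\{\{xyu\}\alpha_1(v)\alpha_2(w)\}-\{\alpha_1(u)\{yxv\}\alpha_2(w)\}$$ for all $u,v,w,x,y,z\in J$. When $\alpha_1=\alpha_2=\alpha$ we write $(J,\{,,\},\alpha)$. It is multiplicative if $\alpha_1=\alpha_2=\alpha$ and $\alpha(\{xyz\})=\{\alpha(x)\alpha(y)\alpha(z)\}$ for all $x,y,z$.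 *)

(* Defs.v *)
From mathcomp Require Import all_boot all_order all_algebra.

Set Implicit Arguments.
Unset Strict Implicit.
Unset Printing Implicit Defensive.

Import GRing.Theory.
Local Open Scope ring_scope.

(* Bilinearity is carried by the type of [mu]; no unit is assumed. *)
Record jordan_algebra (k : fieldType) (A : lmodType k)
    (mu : {bilinear A -> A -> A}) : Prop := JordanAlgebra {
  jordan_comm : forall x y, mu x y = mu y x;
  jordan_identity : forall x y,
    mu (mu (mu x x) y) x = mu (mu x x) (mu y x)
}.

Definition algebra_morphism (k : fieldType) (A : lmodType k)
    (mu : {bilinear A -> A -> A}) (alpha : {linear A -> A}) : Prop :=
  forall x y, alpha (mu x y) = mu (alpha x) (alpha y).

Definition jordan_triple (k : fieldType) (A : lmodType k)
    (mu : {bilinear A -> A -> A}) (x y z : A) : A :=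
  mu x (mu y z) + mu (mu x y) z - mu y (mu x z).

Definition trilinear (k : fieldType) (J : lmodType k)
    (t : J -> J -> J -> J) : Prop :=
  [/\ forall y z, linear (fun x => t x y z),
      forall x z, linear (fun y => t x y z)
    & forall x y, linear (fun z => t x y z)].

Record hom_jordan_triple_system (k : fieldType) (J : lmodType k)
    (t : J -> J -> J -> J) (alpha1 alpha2 : {linear J -> J}) : Prop :=
  HomJordanTripleSystem {
  hjts_trilinear : trilinear t;
  hjts_sym : forall x y z, t x y z = t z y x;
  hjts_identity : forall u v w x y,
    t (alpha1 x) (alpha2 y) (t u v w) - t (alpha1 u) (alpha2 v) (t x y w) =
    t (t x y u) (alpha1 v) (alpha2 w) - t (alpha1 u) (t y x v) (alpha2 w)
}.

Record multiplicative_hom_jordan_triple_system (k : fieldType)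
    (J : lmodType k) (t : J -> J -> J -> J)
    (alpha1 alpha2 : {linear J -> J}) : Prop :=
  MultiplicativeHomJordanTripleSystem {
  mhjts_hjts : hom_jordan_triple_system t alpha1 alpha2;
  mhjts_twist_eq : forall x, alpha1 x = alpha2 x;
  mhjts_mult : forall x y z,
    alpha1 (t x y z) = t (alpha1 x) (alpha1 y) (alpha1 z)
}.

(* Main.v *)
Require Import Defs.
From mathcomp Require Import all_boot all_order all_algebra.
Local Open Scope ring_scope.

(** Write [L x] for multiplication by [x].  Polarizing the Jordan identity
    (which only requires 2 to be invertible) gives that the sum of
    [[L (x y), L z]] over cyclic permutations vanishes, and hence that every
    commutator [[L x, L y]] is a derivation.  The operator
    [w |-> {x y w}] is [L (x y) + [L x, L y]], and the Jordan triple identity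
    splits accordingly: a derivation of the product is a derivation of the triple
    product, and the [L (x y)] part reduces to the polarized Jordan identity.
    Since [alpha] commutes with the triple product, each side of the twisted
    identity is the image under [alpha \o alpha] of the untwisted one. *)

Import GRing.Theory.
Set Implicit Arguments.
Unset Strict Implicit.
Unset Printing Implicit Defensive.

(** Terms for proof by reflection in abelian groups: an equation holds once every atom has the same
    integer coefficient on both sides. *)
Inductive zexpr := ZVar of nat | ZAdd of zexpr & zexpr | ZOpp of zexpr | ZZero.

Fixpoint zeval (V : zmodType) (v : seq V) (e : zexpr) : V :=
  match e with
  | ZVar i => v`_i
  | ZAdd a b => zeval v a + zeval v b
  | ZOpp a => - zeval v a
  | ZZero => 0
  end.

Fixpoint zcoef (e : zexpr) (i : nat) : int :=
  match e with
  | ZVar j => (i == j)%:Z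
  | ZAdd a b => zcoef a i + zcoef b i
  | ZOpp a => - zcoef a i
  | ZZero => 0
  end.

Lemma zeval_sum (V : zmodType) (v : seq V) e :
  zeval v e = \sum_(i < size v) v`_i *~ zcoef e i.
Proof.
elim: e => [j|a IHa b IHb|a IHa|] /=.
- case: (ltnP j (size v)) => [lt_j|le_j].
    rewrite (bigD1 (Ordinal lt_j)) //= eqxx mulr1z big1 ?addr0 // => i.
    by rewrite -val_eqE /= => /negPf->; rewrite mulr0z.
  (* An index past the end of [v] reads the default [0], so it adds nothing to the sum. *)
  rewrite nth_default // big1 // => i _.
  by rewrite (ltn_eqF (leq_trans (ltn_ord i) le_j)) mulr0z.
- by rewrite IHa IHb -big_split; apply: eq_bigr => i _; rewrite mulrzDr.
- by rewrite IHa -sumrN; apply: eq_bigr => i _; rewrite mulrNz.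
- by rewrite big1 // => i _; rewrite mulr0z.
Qed.

Lemma zeval_eq (V : zmodType) (v : seq V) a b :
  all (fun i => zcoef a i == zcoef b i) (iota 0 (size v)) ->
  zeval v a = zeval v b.
Proof.
move=> /allP eq_ab; rewrite !zeval_sum; apply: eq_bigr => i _.
by rewrite (eqP (eq_ab i _)) // mem_iota ltn_ord.
Qed.

Ltac zindex v t :=
  lazymatch v with
  | t :: _ => constr:(0%N)
  | _ :: ?v' => let n := zindex v' t in constr:(n.+1)
  end.

Ltac zatoms v t :=
  lazymatch t with
  | ?a + ?b => let v := zatoms v a in zatoms v b
  | - ?a => zatoms v a
  | 0 => v
  (* [zindex] fails on a new atom; backtracking then adds it to the list. *)
  | _ => match v with
         | _ => let n := zindex v t in v
         | _ => constr:(t :: v)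
         end
  end.

Ltac zreify v t :=
  lazymatch t with
  | ?a + ?b =>
      let a := zreify v a in let b := zreify v b in constr:(ZAdd a b)
  | - ?a => let a := zreify v a in constr:(ZOpp a)
  | 0 => constr:(ZZero)
  | _ => let n := zindex v t in constr:(ZVar n)
  end.

Ltac zmod :=
  lazymatch goal with
  | |- @eq ?V ?l ?r =>
      let v := zatoms (@nil V) l in
      let v := zatoms v r in
      let a := zreify v l in
      let b := zreify v r in
      refine (@zeval_eq _ v a b _); vm_compute; exact isT
  end.

(* Adds the hypothesis [a = b] to a goal [l = r], so that [zmod] can prove linear
   consequences of hypotheses. *)
Lemma eq_addC (V : zmodType) (a b l r : V) : a = b -> l + b = r + a -> l = r.
Proof. by move=> -> /addIr. Qed.

Section JordanAlgebra.

Variables (k : fieldType) (A : lmodType k) (mu : {bilinear A -> A -> A}).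
Hypotheses (char_neq2 : (2%:R : k) != 0) (jordan_mu : jordan_algebra mu).

Local Notation "x ∘ y" := (mu x y) (at level 40, left associativity).
Local Notation T := (jordan_triple mu).

Let muC x y : x ∘ y = y ∘ x := jordan_comm jordan_mu x y.
Let muDl z x y : (x + y) ∘ z = x ∘ z + y ∘ z := linearDl mu z x y.
Let muDr z x y : z ∘ (x + y) = z ∘ x + z ∘ y := linearDr mu z x y.
Let muNl z x : (- x) ∘ z = - (x ∘ z) := linearNl mu z x.
Let muNr z x : z ∘ (- x) = - (z ∘ x) := linearNr mu z x.
Let muPl c z x y : (c *: x + y) ∘ z = c *: (x ∘ z) + y ∘ z :=
  linearPl mu z c x y.
Let muPr c z x y : z ∘ (c *: x + y) = c *: (z ∘ x) + z ∘ y :=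
  linearPr mu z c x y.
Let muE := (muDl, muDr, muNl, muNr).

Lemma jordan_polarized x y z w :
  x ∘ (w ∘ (y ∘ z)) + y ∘ (w ∘ (x ∘ z)) + z ∘ (w ∘ (x ∘ y)) =
  (x ∘ y) ∘ (w ∘ z) + (y ∘ z) ∘ (w ∘ x) + (x ∘ z) ∘ (w ∘ y).
Proof.
have cube t : t ∘ (w ∘ (t ∘ t)) = (t ∘ t) ∘ (w ∘ t).
  by rewrite (muC t (w ∘ _)) (muC w (t ∘ t)) (jordan_identity jordan_mu).
have twice (s : A) : s + s = 0 -> s = 0.
  move=> /eqP; rewrite -mulr2n -scaler_nat scaler_eq0 (negPf char_neq2).
  by move=> /eqP.
apply/eqP; rewrite -subr_eq0; apply/eqP/twice.
(* The alternating sum of [cube] over the nonempty sums of [x], [y], [z] is twice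
   the trilinear identity. *)
apply: (eq_addC (cube (x + y + z))).
apply: (eq_addC (esym (cube (x + y)))).
apply: (eq_addC (esym (cube (x + z)))).
apply: (eq_addC (esym (cube (y + z)))).
apply: (eq_addC (cube x)); apply: (eq_addC (cube y)); apply: (eq_addC (cube z)).
move: muDl muDr muC; move: (mu : A -> A -> A) => m Dl Dr C.
rewrite !(Dl, Dr) (C y x) (C z x) (C z y).
zmod.
Qed.

(** The right side of [jordan_polarized x u v y] is symmetric in [x] and [y], so antisymmetrizing in
    them cancels it and leaves the Leibniz rule. *)
Lemma jordan_commutator_derivation x y u v :
  x ∘ (y ∘ (u ∘ v)) - y ∘ (x ∘ (u ∘ v)) =
  (x ∘ (y ∘ u) - y ∘ (x ∘ u)) ∘ v + u ∘ (x ∘ (y ∘ v) - y ∘ (x ∘ v)).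
Proof.
apply: (eq_addC (jordan_polarized x u v y)).
apply: (eq_addC (esym (jordan_polarized y u v x))).
rewrite (muC (_ - _) v) !muE (muC y x) (muC (x ∘ u)) (muC (x ∘ v)).
zmod.
Qed.

Lemma jordan_triple_sym x y z : T x y z = T z y x.
Proof.
rewrite /jordan_triple (muC y z) (muC y x) (muC x (z ∘ y)) (muC z (x ∘ y)).
by rewrite (muC z x) (addrC ((z ∘ y) ∘ x)).
Qed.

Lemma jordan_triple_linear_l y z : linear (fun x => T x y z).
Proof.
move=> c u v; rewrite /jordan_triple !(muPl, muPr).
rewrite scalerBr scalerDr [RHS]addrACA -opprD; congr (_ - _).
exact: addrACA.
Qed.

Lemma jordan_triple_linear_m x z : linear (fun y => T x y z).
Proof.
move=> c u v; rewrite /jordan_triple !(muPl, muPr).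
rewrite scalerBr scalerDr [RHS]addrACA -opprD; congr (_ - _).
exact: addrACA.
Qed.

Lemma jordan_triple_trilinear : trilinear T.
Proof.
split; [exact: jordan_triple_linear_l | exact: jordan_triple_linear_m|].
move=> x y c u v; rewrite !(jordan_triple_sym x y).
exact: jordan_triple_linear_l.
Qed.

Lemma jordan_triple_derivation x y u v w :
  let d p := x ∘ (y ∘ p) - y ∘ (x ∘ p) in
  d (T u v w) = T (d u) v w + T u (d v) w + T u v (d w).
Proof.
have der p q := jordan_commutator_derivation x y p q.
move=> d.
have dM p q : d (p ∘ q) = d p ∘ q + p ∘ d q by exact: der.
have dD p q : d (p + q) = d p + d q by rewrite /d !muE; zmod.
have dN p : d (- p) = - d p by rewrite /d !muE; zmod.
rewrite /jordan_triple !(dD, dN, dM) !muE; move: d {dM dD dN} => d; zmod.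
Qed.

(** Take both sides as operators on [w]. Since [[L u, L v]] is a derivation, its commutator with
    [L a] is again a multiplication; what remains is the polarized identity for [a], [u], [v]. *)
Lemma jordan_triple_mul a u v w :
  a ∘ T u v w = T (a ∘ u) v w - T u (a ∘ v) w + T u v (a ∘ w).
Proof.
rewrite /jordan_triple !muE.
apply: (eq_addC (esym (jordan_commutator_derivation u v a w))).
apply: (eq_addC (jordan_polarized a u v w)).
rewrite !muE (muC v a) (muC u a) (muC (a ∘ u) v) !(muC w).
zmod.
Qed.

(** Exchanging [x] and [y] flips the sign of the commutator [d] alone. So [- T y x] acts on the
    middle slot as [- L (x y) + d], which matches the signs in [jordan_triple_mul] and
    [jordan_triple_derivation]. *)
Lemma jordan_triple_identity u v w x y :
  T x y (T u v w) - T u v (T x y w) = T (T x y u) v w - T u (T y x v) w.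
Proof.
pose d p := x ∘ (y ∘ p) - y ∘ (x ∘ p).
have [Tl Tm Tr] := jordan_triple_trilinear.
have TDl p q r s : T (p + q) r s = T p r s + T q r s.
  by rewrite -[p]scale1r Tl !scale1r.
have TDm p q r s : T p (q + r) s = T p q s + T p r s.
  by rewrite -[q]scale1r Tm !scale1r.
have TDr p q r s : T p q (r + s) = T p q r + T p q s.
  by rewrite -[r]scale1r Tr !scale1r.
have TNm p q r : T p (- q) r = - T p q r.
  by rewrite /jordan_triple !muE; zmod.
have Txy p : T x y p = (x ∘ y) ∘ p + d p by rewrite /jordan_triple /d; zmod.
have Tyx p : T y x p = (x ∘ y) ∘ p - d p.
  by rewrite /jordan_triple /d (muC y x); zmod.
rewrite !Txy Tyx TDl TDm TDr TNm.
apply: (eq_addC (jordan_triple_mul (x ∘ y) u v w)).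
apply: (eq_addC (jordan_triple_derivation x y u v w)).
rewrite -!/(d _); zmod.
Qed.

End JordanAlgebra.

Theorem corollary3p14 (k : fieldType) (char0 : [pchar k] =i pred0)
    (A : lmodType k) (mu : {bilinear A -> A -> A}) (alpha : {linear A -> A})
    (jordan_mu : jordan_algebra mu)
    (morph_alpha : algebra_morphism mu alpha) :
  multiplicative_hom_jordan_triple_system
    (fun x y z => alpha (jordan_triple mu x y z)) alpha alpha.
Proof.
have char_neq2 : (2%:R : k) != 0.
  by have := char0 2; rewrite !inE /= => ->.
have alphaT x y z : alpha (jordan_triple mu x y z) =
    jordan_triple mu (alpha x) (alpha y) (alpha z).
  by rewrite /jordan_triple !(raddfB, raddfD) /= !morph_alpha.
have [Tl Tm Tr] := jordan_triple_trilinear jordan_mu.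
split=> //; last by move=> x y z; rewrite -alphaT.
split.
- by split=> [y z|x z|x y] c u v; rewrite (Tl, Tm, Tr) linearP.
- by move=> x y z; rewrite (jordan_triple_sym jordan_mu).
move=> u v w x y.
(* Read backwards, [alphaT] pulls an [alpha] out of each outer triple product; the twisted product
   supplies the second one. *)
by rewrite -!alphaT -!raddfB (jordan_triple_identity char_neq2 jordan_mu).
Qed.
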